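(* Let $n\ge 1$ and let $s_k, y_k \in \mathbb{R}^n$ be arbitrary vectors. For every $\alpha_k > 0$ and every symmetric positive definite $H_k \in \mathbb{R}^{n\times n}$, the optimization problem over symmetric matrices $B\in\mathbb{R}^{n\times n}$ $$ \underset{B}{\text{minimize}}\quad \operatorname{tr}(BH_k) - \log(\det(BH_k)) + \alpha_k\, \|s_k - B^{-1}y_k\|_B^2 \qquad \text{subject to}\quad B \succ 0 $$ has a unique positive definite solution $B^{\star}$. Moreover, letting $H_{k+1} = (B^{\star})^{-1}$, one has $$ H_{k+1} = H_k + \alpha_k s_k s_k^T - \frac{\alpha_k}{\gamma_k^2}\bigl(H_ky_k + \alpha_k (s_k^Ty_k)s_k\bigr)\bigl(H_ky_k + \alpha_k (s_k^Ty_k)s_k\bigr)^T, $$ where $$ \gamma_k = 0.5 + \sqrt{0.25 + \alpha_k\, y_k^TH_ky_k + \alpha_k^2 (s_k^Ty_k)^2}. $$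
   Context: Notation: $B \succ 0$ means that $B$ is symmetric positive definite. For a symmetric positive definite matrix $B$ and a vector $z\in\mathbb{R}^n$, $\|z\|_B^2 := z^T B z$. *)

(* Defs.v *)
From mathcomp Require Import all_boot all_order all_algebra.
From mathcomp Require Import reals exp.

Set Implicit Arguments.
Unset Strict Implicit.
Unset Printing Implicit Defensive.

Import Order.TTheory GRing.Theory Num.Theory.

Local Open Scope ring_scope.

(* u^T v, read off the 1 x 1 matrix product. *)
Definition dotv (R : realType) (n : nat) (u v : 'cV[R]_n) : R :=
  (u^T *m v) 0 0.

(* ||z||_B^2 *)
Definition sqnormB (R : realType) (n : nat) (B : 'M[R]_n) (z : 'cV[R]_n) : R :=
  dotv z (B *m z).

(* Symmetry is part of positive definiteness. *)
Definition posdefmx (R : realType) (n : nat) (B : 'M[R]_n) : Prop :=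
  B \is symmetricmx /\ forall z : 'cV[R]_n, z != 0 -> 0 < sqnormB B z.

(* [ln] and [invmx] are total (junk values off the positive reals and the
   invertible matrices); for B and H positive definite, det (B H) > 0 and B is
   invertible, so the genuine values are used on the feasible set. *)
Definition objective (R : realType) (n : nat) (alpha : R) (H : 'M[R]_n)
    (s y : 'cV[R]_n) (B : 'M[R]_n) : R :=
  \tr (B *m H) - ln (\det (B *m H)) + alpha * sqnormB B (s - invmx B *m y).

Definition minimizer_on (T : Type) (R : realType) (feasible : T -> Prop)
    (f : T -> R) (x : T) : Prop :=
  feasible x /\ forall x' : T, feasible x' -> f x <= f x'.

(* Main.v *)
Require Import Defs.
From mathcomp Require Import all_boot all_order all_algebra.
From mathcomp Require Import reals exp.
From mathcomp Require Import ring lra.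

(** Put [M = H + alpha s s^T]. Up to a constant the objective is
    [tr (B M) - ln (det B) + alpha y^T B^-1 y], whose critical points satisfy
    [M = X + alpha (X y) (X y)^T] with [X = B^-1]; the ansatz
    [X = M - c (M y) (M y)^T] solves this equation for [c = alpha / gamma^2].
    Substituting [M] back, the objective becomes
    [tr (B X) - ln (det (B X)) + alpha ||X y - B^-1 y||_B^2] plus a constant.
    The first part is at least [n], with equality only at [B = X^-1], where the
    second part vanishes. The bound on the first part follows from Cholesky
    factorizations: if [L] is lower triangular, [tr (L L^T)] is the sum of the
    squared entries of [L], [det (L L^T)] the product of the squared diagonal
    ones, and [ln x <= x - 1]. *)

Set Implicit Arguments.
Unset Strict Implicit.
Unset Printing Implicit Defensive.

Import Order.TTheory GRing.Theory Num.Theory.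

Local Open Scope ring_scope.

(** * Dot products, rank-one matrices and positive definite quadratic forms *)

Section QuadraticForms.
Variable R : realType.
Implicit Types n : nat.

Lemma dotvE n (u v : 'cV[R]_n) : dotv u v = \sum_i u i 0 * v i 0.
Proof. by rewrite /dotv mxE; apply: eq_bigr => i _; rewrite mxE. Qed.

Lemma dotvC n (u v : 'cV[R]_n) : dotv u v = dotv v u.
Proof. by rewrite !dotvE; apply: eq_bigr => i _; rewrite mulrC. Qed.

Lemma dotvDr n (u v w : 'cV[R]_n) : dotv u (v + w) = dotv u v + dotv u w.
Proof. by rewrite /dotv mulmxDr mxE. Qed.

Lemma dotvNr n (u v : 'cV[R]_n) : dotv u (- v) = - dotv u v.
Proof. by rewrite /dotv mulmxN mxE. Qed.

Lemma dotvZr n a (u v : 'cV[R]_n) : dotv u (a *: v) = a * dotv u v.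
Proof. by rewrite /dotv -scalemxAr mxE. Qed.

Lemma dotv0r n (u : 'cV[R]_n) : dotv u 0 = 0.
Proof. by rewrite /dotv mulmx0 mxE. Qed.

Lemma dotvDl n (u v w : 'cV[R]_n) : dotv (u + v) w = dotv u w + dotv v w.
Proof. by rewrite dotvC dotvDr !(dotvC w). Qed.

Lemma dotvNl n (u v : 'cV[R]_n) : dotv (- u) v = - dotv u v.
Proof. by rewrite dotvC dotvNr dotvC. Qed.

Lemma dotvZl n a (u v : 'cV[R]_n) : dotv (a *: u) v = a * dotv u v.
Proof. by rewrite dotvC dotvZr dotvC. Qed.

Lemma dotv0l n (u : 'cV[R]_n) : dotv 0 u = 0.
Proof. by rewrite dotvC dotv0r. Qed.

Lemma dotv_mulmx m n (A : 'M[R]_(m, n)) u v :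
  dotv (A *m u) v = dotv u (A^T *m v).
Proof. by rewrite /dotv trmx_mul mulmxA. Qed.

Lemma dotv_col_mx m n (u1 v1 : 'cV[R]_m) (u2 v2 : 'cV[R]_n) :
  dotv (col_mx u1 u2) (col_mx v1 v2) = dotv u1 v1 + dotv u2 v2.
Proof. by rewrite /dotv tr_col_mx mul_row_col mxE. Qed.

Lemma rank1_mulmx n (u v z : 'cV[R]_n) : (u *m v^T) *m z = dotv v z *: u.
Proof.
by rewrite -mulmxA [v^T *m z]mx11_scalar mul_mx_scalar.
Qed.

Lemma mxtrace_rank1 n (B : 'M[R]_n) (u : 'cV[R]_n) :
  \tr (B *m (u *m u^T)) = sqnormB B u.
Proof. by rewrite mulmxA mxtrace_mulC /mxtrace big_ord1. Qed.

Lemma posdefmx_tr n (B : 'M[R]_n) : posdefmx B -> B^T = B.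
Proof.
by case=> /is_hermitianmxP; rewrite expr0 scale1r map_mx_id.
Qed.

Lemma posdefmxP n (B : 'M[R]_n) : B^T = B ->
  (forall z : 'cV[R]_n, z != 0 -> 0 < sqnormB B z) -> posdefmx B.
Proof.
move=> BT Bpos; split=> //; apply/is_hermitianmxP.
by rewrite expr0 scale1r map_mx_id.
Qed.

Lemma sqnormB_ge0 n (B : 'M[R]_n) z : posdefmx B -> 0 <= sqnormB B z.
Proof.
case=> _ Bpos; have [->|/Bpos/ltW//] := eqVneq z 0.
by rewrite /sqnormB mulmx0 dotv0r.
Qed.

(** A nonzero kernel vector would make the quadratic form vanish. *)
Lemma posdefmx_unit n (B : 'M[R]_n) : posdefmx B -> B \in unitmx.
Proof.
move=> Bpd; rewrite -unitmx_tr -row_free_unit; apply: inj_row_free => v vB.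
apply/eqP; rewrite -(inj_eq trmx_inj) trmx0; apply/negPn/negP => v_neq0.
have := Bpd.2 _ v_neq0; rewrite /sqnormB -[B]trmxK -trmx_mul vB trmx0.
by rewrite dotv0r ltxx.
Qed.

Lemma sqnormB_congr m n (B : 'M[R]_m) (P : 'M[R]_(m, n)) z :
  sqnormB (P^T *m B *m P) z = sqnormB B (P *m z).
Proof. by rewrite /sqnormB dotv_mulmx !mulmxA. Qed.

Lemma posdefmx_congr n (B P : 'M[R]_n) : P \in unitmx ->
  posdefmx B -> posdefmx (P^T *m B *m P).
Proof.
move=> Pu Bpd; apply: posdefmxP => [|z z_neq0].
  by rewrite !trmx_mul trmxK (posdefmx_tr Bpd) mulmxA.
rewrite sqnormB_congr; apply: Bpd.2; apply: contraNneq z_neq0 => Pz0.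
by rewrite -(mulKmx Pu z) Pz0 mulmx0.
Qed.

(** By symmetry, the inverse is the congruence of [B] by [invmx B]. *)
Lemma posdefmx_inv n (B : 'M[R]_n) : posdefmx B -> posdefmx (invmx B).
Proof.
move=> Bpd; have Bu := posdefmx_unit Bpd.
have -> : invmx B = (invmx B)^T *m B *m invmx B.
  by rewrite mulmxK // trmx_inv (posdefmx_tr Bpd).
by apply: posdefmx_congr; rewrite ?unitmx_inv.
Qed.

(** Symmetry cancels [B] against its inverse in the cross terms, so the middle term no longer
    depends on [B]. *)
Lemma sqnormB_subl n (B : 'M[R]_n) (s y : 'cV[R]_n) : posdefmx B ->
  sqnormB B (s - invmx B *m y) =
  sqnormB B s - 2 * dotv s y + sqnormB (invmx B) y.
Proof.
move=> Bpd; have Bu := posdefmx_unit Bpd.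
rewrite /sqnormB mulmxBr mulmxA mulmxV // mul1mx.
rewrite !(dotvDl, dotvNl, dotvDr, dotvNr) !(dotv_mulmx _ y).
rewrite trmx_inv (posdefmx_tr Bpd) mulKmx // (dotvC y s).
ring.
Qed.

(** * Schur complements and Cholesky factorization *)

Lemma posdefmx_schur n (a : R) (b : 'cV[R]_n) (D : 'M[R]_n) :
  posdefmx (block_mx a%:M b^T b D : 'M_(1 + n)) ->
  0 < a /\ posdefmx (D - a^-1 *: (b *m b^T)).
Proof.
move=> Cpd; have a_gt0 : 0 < a.
  have := Cpd.2 (col_mx 1%:M 0); rewrite /sqnormB mul_block_col !mulmx0 !addr0.
  rewrite !mulmx1 dotv_col_mx dotv0l addr0 dotvE big_ord1 !mxE mul1r mulr1n.
  apply.
  rewrite -(inj_eq trmx_inj) tr_col_mx; apply/eqP => /rowP/(_ (lshift n 0)).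
  by rewrite trmx0 row_mxEl !mxE /= => /eqP; rewrite oner_eq0.
split=> //; apply: posdefmxP => [|z z_neq0].
  have := posdefmx_tr Cpd; rewrite tr_block_mx => /eq_block_mx[_ _ _ DT].
  by rewrite linearB linearZ /= trmx_mul trmxK DT.
(* The first coordinate is chosen to kill the top block of the product; what remains is the Schur
   complement acting on [z]. *)
have := Cpd.2 (col_mx (- (a^-1 * dotv b z))%:M z).
rewrite /sqnormB mul_block_col -scalar_mxM [b^T *m z]mx11_scalar -/(dotv b z).
have -> : a * - (a^-1 * dotv b z) = - dotv b z.
  by rewrite mulrN mulrA divff ?mul1r ?gt_eqF.
rewrite -raddfD addNr raddf0 dotv_col_mx dotv0r add0r.
have -> : b *m (- (a^-1 * dotv b z))%:M + D *m z =
          (D - a^-1 *: (b *m b^T)) *m z.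
  by rewrite mulmxBl -scalemxAl rank1_mulmx scalerA mul_mx_scalar scaleNr addrC.
apply; apply: contraNneq z_neq0 => /(congr1 dsubmx).
by rewrite col_mxKd => ->; rewrite linear0.
Qed.

(** Induction on the size: the first column of the factor is [Num.sqrt a] above [b / Num.sqrt a],
    and its lower right block is the factor of the Schur complement of [a]. *)
Lemma cholesky n (C : 'M[R]_n) : posdefmx C ->
  exists2 L : 'M[R]_n, is_trig_mx L & C = L *m L^T.
Proof.
elim: n C => [|n IHn] C Cpd.
  by exists 0; [exact: mx0_is_trig | apply/matrixP => -[]].
pose a := C 0 0; pose b : 'cV[R]_n := @dlsubmx _ 1 n 1 n C.
pose D : 'M[R]_n := @drsubmx _ 1 n 1 n C.
have aE : @ulsubmx _ 1 n 1 n C = a%:M.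
  rewrite [LHS]mx11_scalar !mxE.
  by congr (fun_of_matrix C _ _)%:M; apply: val_inj.
have bE : @ursubmx _ 1 n 1 n C = b^T.
  by rewrite trmx_dlsub [X in _ = ursubmx X](posdefmx_tr Cpd).
have CE : C = block_mx (a%:M : 'M_1) b^T b D.
  by rewrite -aE -bE; exact: esym (@submxK _ 1 n 1 n C).
rewrite CE in Cpd *; have [a_gt0 /IHn[L Ltrig SE]] := posdefmx_schur Cpd.
have sa_neq0 : Num.sqrt a != 0 by rewrite gt_eqF ?sqrtr_gt0.
(* The size is displayed as [1 + n] so that block matrices typecheck. *)
change (exists2 L : 'M[R]_(1 + n), is_trig_mx L &
  block_mx a%:M b^T b D = L *m L^T).
exists (block_mx (Num.sqrt a)%:M 0 ((Num.sqrt a)^-1 *: b) L).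
  by rewrite is_trig_block_mx // eqxx scalar_mx_is_trig Ltrig.
rewrite tr_block_mx mulmx_block !trmx0 !mulmx0 !mul0mx !addr0 tr_scalar_mx.
rewrite -SE -scalar_mxM -expr2 sqr_sqrtr ?ltW // linearZ /=.
rewrite mul_scalar_mx mul_mx_scalar !scalerA divff // !scale1r.
rewrite -scalemxAl -scalemxAr scalerA -invfM -expr2 sqr_sqrtr ?ltW //.
by rewrite addrC subrK.
Qed.

Lemma det_posdefmx_gt0 n (C : 'M[R]_n) : posdefmx C -> 0 < \det C.
Proof.
move=> Cpd; have := posdefmx_unit Cpd; rewrite unitmxE unitfE.
have [L _ ->] := cholesky Cpd.
by rewrite det_mulmx det_tr -expr2 expf_eq0 /= exprn_even_gt0.
Qed.

(** * Logarithm inequalities and the sharp lower bound on trace minus log-determinant *)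

Lemma ln_leB1 (x : R) : 0 < x -> ln x <= x - 1.
Proof.
move=> x_gt0; rewrite -[x in ln x](subrK 1) addrC le_ln1Dx //; lra.
Qed.

Lemma ln_ltB1 (x : R) : 0 < x -> x != 1 -> ln x < x - 1.
Proof.
move=> x_gt0 x_neq1; have lnx_neq0 : ln x != 0 by rewrite ln_eq0.
by have := expR_gt1Dx lnx_neq0; rewrite lnK ?posrE //; lra.
Qed.

Lemma ln_prod (I : finType) (F : I -> R) : (forall i, 0 < F i) ->
  ln (\prod_i F i) = \sum_i ln (F i).
Proof.
move=> F_gt0; suff [] : 0 < \prod_i F i /\ ln (\prod_i F i) = \sum_i ln (F i).
  by [].
apply: (big_rec2 (fun p q => 0 < p /\ ln p = q)) => [|i p q _ [p_gt0 <-]].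
  by rewrite ltr01 ln1.
by rewrite mulr_gt0 ?lnM ?posrE.
Qed.

Lemma mxtrace_mulmx_tr n (L : 'M[R]_n) :
  \tr (L *m L^T) = \sum_i L i i ^+ 2 + \sum_i \sum_(j | j != i) L i j ^+ 2.
Proof.
rewrite -big_split; apply: eq_bigr => i _.
by rewrite mxE (bigD1 i) //=; congr (_ + _);
  [|apply: eq_bigr => j _]; rewrite mxE.
Qed.

(** The excess over [n] is a sum of nonnegative terms: squared off-diagonal entries of the Cholesky
    factor, and [x - 1 - ln x] at its squared diagonal entries. If it vanishes, the factor is
    diagonal with entries of square 1; their signs disappear in [L *m L^T]. *)
Lemma tr_sub_ln_det n (C : 'M[R]_n) : posdefmx C ->
  n%:R <= \tr C - ln (\det C) /\ (\tr C - ln (\det C) <= n%:R -> C = 1%:M).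
Proof.
move=> Cpd; have := posdefmx_unit Cpd; rewrite unitmxE unitfE.
have [L Ltrig ->] := cholesky Cpd.
rewrite det_mulmx det_tr (det_trig Ltrig) -big_split mxtrace_mulmx_tr /=.
move=> /prodf_neq0 L_neq0; have d_gt0 i : 0 < L i i * L i i.
  by have := L_neq0 i isT; rewrite -expr2 expf_eq0 /= exprn_even_gt0.
rewrite ln_prod //; set off := \sum_i \sum_(j | j != i) _.
have off_ge0 : 0 <= off.
  by apply: sumr_ge0 => i _; apply: sumr_ge0 => j _; apply: sqr_ge0.
pose e i := L i i ^+ 2 - ln (L i i * L i i) - 1.
have e_ge0 i : 0 <= e i by have := ln_leB1 (d_gt0 i); rewrite /e expr2; lra.
have -> : \sum_i L i i ^+ 2 + off - \sum_i ln (L i i * L i i) =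
          n%:R + (off + \sum_i e i).
  rewrite /e !sumrB sumr_const card_ord; ring.
have esum_ge0 : 0 <= \sum_i e i by apply: sumr_ge0.
split; first by rewrite lerDl addr_ge0.
rewrite gerDl => le0.
have /eqP : off = 0 by lra.
rewrite psumr_eq0 => [/allP off0|i _]; last first.
  by apply: sumr_ge0 => j _; apply: sqr_ge0.
have /eqP : \sum_i e i = 0 by lra.
rewrite psumr_eq0 => [/allP e0|//].
have L0 i j : j != i -> L i j = 0.
  move=> ji; have /implyP/(_ isT) := off0 i (mem_index_enum i).
  rewrite psumr_eq0 => [/allP/(_ j (mem_index_enum j))|k _]; last exact: sqr_ge0.
  by rewrite ji /= sqrf_eq0 => /eqP.
have L1 i : L i i * L i i = 1.
  apply/eqP/negPn/negP => /(ln_ltB1 (d_gt0 i)).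
  have /implyP/(_ isT)/eqP := e0 i (mem_index_enum i); rewrite /e expr2; lra.
apply/matrixP => i j; rewrite !mxE (bigD1 i) //= big1 => [|k ki]; last first.
  by rewrite L0 ?mul0r.
rewrite mxE addr0; have [<-|ij] := eqVneq i j; first by rewrite L1.
by rewrite (L0 j i) ?mulr0.
Qed.

(** [B *m X] need not be symmetric, but for [X = L *m L^T] it has the trace and determinant of the
    positive definite [L^T *m B *m L]. *)
Lemma tr_sub_ln_det_mul n (B X : 'M[R]_n) : posdefmx B -> posdefmx X ->
  n%:R <= \tr (B *m X) - ln (\det (B *m X)) /\
  (\tr (B *m X) - ln (\det (B *m X)) <= n%:R -> B *m X = 1%:M).
Proof.
move=> Bpd Xpd; have [L _ XE] := cholesky Xpd.
have Lu : L \in unitmx.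
  by have := posdefmx_unit Xpd; rewrite XE unitmx_mul => /andP[].
have [] := tr_sub_ln_det (posdefmx_congr Lu Bpd).
have -> : \tr (L^T *m B *m L) = \tr (B *m X).
  by rewrite -mulmxA mxtrace_mulC XE mulmxA.
have -> : \det (L^T *m B *m L) = \det (B *m X).
  by rewrite XE !det_mulmx; ring.
move=> ge_n eq_n; split=> // /eq_n.
by rewrite -mulmxA => /mulmx1C; rewrite XE mulmxA.
Qed.

End QuadraticForms.

(** * Unique minimizer from a solution of the stationarity equation *)

Section Update.
Variables (R : realType) (n : nat) (alpha : R) (s y : 'cV[R]_n) (H X : 'M[R]_n).
Hypotheses (alpha_gt0 : 0 < alpha) (H_posdef : posdefmx H).
Hypothesis X_posdef : posdefmx X.
Hypothesis stationary :
  H + alpha *: (s *m s^T) = X + alpha *: ((X *m y) *m (X *m y)^T).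

(** Multiplying the stationarity equation by [B] and taking traces trades [H], [s] for [X],
    [X *m y]. The cross terms and the split logarithms leave only a constant independent of [B]. *)
Lemma objective_stationary B : posdefmx B ->
  objective alpha H s y B =
  objective alpha X (X *m y) y B +
  (ln (\det X) - ln (\det H) + 2 * alpha * (dotv (X *m y) y - dotv s y)).
Proof.
move=> B_posdef; have := congr1 (fun A => \tr (B *m A)) stationary.
rewrite !mulmxDr -!scalemxAr !mxtraceD !mxtraceZ !mxtrace_rank1 => trE.
rewrite /objective !sqnormB_subl // !det_mulmx !lnM ?posrE ?det_posdefmx_gt0 //.
lra.
Qed.

Lemma unique_minimizer_stationary :
  unique (minimizer_on (@posdefmx R n) (objective alpha H s y)) (invmx X).
Proof.
have Xu := posdefmx_unit X_posdef; have iX_posdef := posdefmx_inv X_posdef.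
have min_val : objective alpha X (X *m y) y (invmx X) = n%:R.
  rewrite /objective invmxK subrr /sqnormB mulmx0 dotv0r mulr0 addr0.
  by rewrite mulVmx // mxtrace1 det1 ln1 subr0.
have pen_ge0 B : posdefmx B ->
    0 <= alpha * sqnormB B (X *m y - invmx B *m y).
  by move=> Bpd; rewrite mulr_ge0 ?sqnormB_ge0 // ltW.
split=> [|B [B_posdef /(_ _ iX_posdef)]].
  split=> // B B_posdef; rewrite !objective_stationary // lerD2r min_val.
  have [ge_n _] := tr_sub_ln_det_mul B_posdef X_posdef.
  by rewrite (le_trans ge_n) // lerDl pen_ge0.
rewrite !objective_stationary // lerD2r min_val /objective => le_n.
have [_ eq_n] := tr_sub_ln_det_mul B_posdef X_posdef.
(* A competing minimizer has total value at most [n], and its penalty is nonnegative, so the trace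
   part attains its lower bound. *)
have /eq_n BX1 : \tr (B *m X) - ln (\det (B *m X)) <= n%:R.
  by apply: le_trans le_n; rewrite lerDl pen_ge0.
by rewrite -[RHS](mulmxK Xu) BX1 mul1mx.
Qed.

End Update.

(** * Rank-one downdate solving the stationarity equation *)

Section Downdate.
Variables (R : realType) (n : nat) (alpha gamma : R) (y : 'cV[R]_n).
Variable M : 'M[R]_n.
Hypotheses (alpha_gt0 : 0 < alpha) (gamma_gt0 : 0 < gamma).
Hypothesis M_posdef : posdefmx M.
Hypothesis gammaE : gamma ^+ 2 = gamma + alpha * sqnormB M y.

Let v := M *m y.
Let X := M - (alpha / gamma ^+ 2) *: (v *m v^T).

(** The quadratic equation for [gamma] is what reduces the factor
    [1 - (alpha / gamma ^+ 2) * sqnormB M y] to [gamma^-1]. *)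
Lemma downdate_mulmx : X *m y = gamma^-1 *: v.
Proof.
rewrite /X mulmxBl -scalemxAl rank1_mulmx scalerA -/v -{1}[v]scale1r -scalerBl.
congr (_ *: _); rewrite dotvC -/(sqnormB M y).
have : alpha * sqnormB M y = gamma ^+ 2 - gamma by rewrite gammaE; ring.
have g0 : gamma != 0 by rewrite gt_eqF.
by move=> qE; rewrite mulrAC qE; field.
Qed.

Lemma downdate_stationary :
  M = X + alpha *: ((X *m y) *m (X *m y)^T).
Proof.
rewrite downdate_mulmx linearZ /= -scalemxAl -scalemxAr !scalerA /X.
by rewrite -mulrA -invfM -expr2 subrK.
Qed.

Lemma downdate_posdefmx : posdefmx X.
Proof.
have MT := posdefmx_tr M_posdef.
apply: posdefmxP => [|z z_neq0].
  by rewrite linearB linearZ /= trmx_mul trmxK MT.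
pose c := alpha / gamma ^+ 2; pose p := dotv v z.
have c_gt0 : 0 < c by rewrite divr_gt0 ?exprn_gt0.
have g0 : gamma != 0 by rewrite gt_eqF.
have cq : c * sqnormB M y = 1 - gamma^-1.
  have qE : alpha * sqnormB M y = gamma ^+ 2 - gamma by rewrite gammaE; ring.
  by rewrite /c mulrAC qE; field.
have XE : sqnormB X z = sqnormB M z - c * p ^+ 2.
  rewrite /sqnormB mulmxBl -scalemxAl rank1_mulmx scalerA dotvDr dotvNr dotvZr.
  by rewrite (dotvC z v) -/p /c; ring.
(* Completing the square along y makes z^T X z visibly nonnegative. *)
have square : sqnormB X z = sqnormB M (z - (c * p) *: y) + c / gamma * p ^+ 2.
  rewrite XE /sqnormB mulmxBr -scalemxAr !(dotvDl, dotvNl, dotvDr, dotvNr).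
  rewrite !(dotvZl, dotvZr) -/v -!/(sqnormB M _) (dotvC z v) -/p.
  have -> : dotv y (M *m z) = p by rewrite /p /v dotv_mulmx MT.
  rewrite -/(sqnormB M y).
  have -> : c * p * (c * p * sqnormB M y) = c * p ^+ 2 * (c * sqnormB M y) by ring.
  by rewrite cq; ring.
(* The completed square vanishes when [z] is [(c * p) *: y], so strictness comes from the remaining
   term if [p] is nonzero; if [p] is zero, the forms of [X] and [M] agree at [z]. *)
have [p0|p_neq0] := eqVneq p 0.
  by rewrite XE p0 expr0n mulr0 subr0; apply: M_posdef.2.
by rewrite square ltr_wpDl ?sqnormB_ge0 // mulr_gt0 ?divr_gt0 ?exprn_even_gt0.
Qed.

End Downdate.

Theorem theorem3p1 (R : realType) (n : nat) (n_ge1 : (1 <= n)%N)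
    (s y : 'cV[R]_n) (alpha : R) (alpha_gt0 : 0 < alpha)
    (H : 'M[R]_n) (H_posdef : posdefmx H) :
  exists Bstar : 'M[R]_n,
    unique (minimizer_on (@posdefmx R n) (objective alpha H s y)) Bstar /\
    let gamma : R :=
      2^-1 + Num.sqrt (4^-1 + alpha * dotv y (H *m y)
                            + alpha ^+ 2 * dotv s y ^+ 2) in
    let v : 'cV[R]_n := H *m y + (alpha * dotv s y) *: s in
    invmx Bstar =
      H + alpha *: (s *m s^T) - (alpha / gamma ^+ 2) *: (v *m v^T).
Proof.
pose M : 'M[R]_n := H + alpha *: (s *m s^T).
pose q : R := alpha * sqnormB H y + alpha ^+ 2 * dotv s y ^+ 2.
pose gamma : R := 2^-1 + Num.sqrt (4^-1 + q).
have q_ge0 : 0 <= q.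
  by rewrite addr_ge0 // mulr_ge0 ?sqr_ge0 ?sqnormB_ge0 ?(ltW alpha_gt0).
have gamma_gt0 : 0 < gamma by rewrite ltr_wpDr ?sqrtr_ge0 // invr_gt0.
have MyE : M *m y = H *m y + (alpha * dotv s y) *: s.
  by rewrite mulmxDl -scalemxAl rank1_mulmx scalerA.
have M_sqnorm z : sqnormB M z = sqnormB H z + alpha * dotv s z ^+ 2.
  rewrite /sqnormB mulmxDl -scalemxAl rank1_mulmx scalerA dotvDr dotvZr.
  by rewrite (dotvC z s); ring.
have M_posdef : posdefmx M.
  apply: posdefmxP => [|z z_neq0].
    by rewrite linearD linearZ /= trmx_mul trmxK (posdefmx_tr H_posdef).
  rewrite M_sqnorm ltr_wpDr ?(H_posdef.2 _ z_neq0) //.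
  by rewrite mulr_ge0 ?sqr_ge0 ?(ltW alpha_gt0).
(* Here [q] equals [alpha * sqnormB M y], and [gamma] is the positive root of [t ^+ 2 = t + q]. *)
have gammaE : gamma ^+ 2 = gamma + alpha * sqnormB M y.
  have -> : alpha * sqnormB M y = q by rewrite M_sqnorm /q; ring.
  by rewrite /gamma sqrrD sqr_sqrtr; [field | lra].
(* The minimizer is given as the inverse of the downdated matrix, so the update formula follows by
   inverting back. *)
exists (invmx (M - (alpha / gamma ^+ 2) *: ((M *m y) *m (M *m y)^T))).
split=> [|g v].
  apply: unique_minimizer_stationary => //; first exact: downdate_posdefmx.
  exact: downdate_stationary.
by rewrite invmxK /v /g -MyE -(addrA 4^-1).
Qed.
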